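(* Let $(W,S)$ be a Coxeter system with $S$ finite and $\theta$ an involutive automorphism of $(W,S)$. Let $u\le v$ be elements of $\iota(\theta)$. If $u\star s=\theta(s)us$ for some $s\in D_R(v)\setminus D_R(u)$, then the open interval $(u,v)$ in $\mathrm{Br}(\iota(\theta))$ is homotopy equivalent to the suspension of the open interval $(u\star s,v)$ in $\mathrm{Br}(\iota(\theta))$.
   Context: An automorphism of $(W,S)$ is a group automorphism of $W$ mapping $S$ onto $S$; involutive means $\theta^2=\mathrm{id}$. Twisted identities: $\iota(\theta)=\{\theta(w^{-1})w\mid w\in W\}$. For $w\in W$, $s\in S$: $w\star s=ws$ if $\theta(s)ws=w$, else $w\star s=\theta(s)ws$. $D_R(w)=\{s\in S\mid \ell(ws)<\ell(w)\}$, $\ell$ the Coxeter length. Bruhat order: $u\le v$ iff for every reduced expression $s_1\cdots s_k$ of $v$ there are $i_1<\cdots<i_m$ with $u=s_{i_1}\cdots s_{i_m}$; $\mathrm{Br}(\iota(\theta))$ is its restriction to $\iota(\theta)$. For $a\le b$ in a poset, $(a,b)=\{x\mid a<x<b\}$; topological statements refer to order complexes (simplicial complexes of chains).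
   Formalization: When u⋆s = v, the claim read literally fails (the suspension of the empty set is two points, while (u,v) is empty); here the complex of (v,v) is taken to be the degenerate complex with no faces, whose suspension is empty. All cases u⋆s < v are unchanged. *)

(* Defs.v *)
From HB Require Import structures.
From mathcomp Require Import all_boot all_order all_algebra.
From mathcomp Require Import all_classical all_reals all_analysis.
Import Order.TTheory GRing.Theory Num.Theory.
Import numFieldNormedType.Exports.

Set Implicit Arguments.
Unset Strict Implicit.
Unset Printing Implicit Defensive.

Local Open Scope classical_set_scope.

Section Coxeter.
Local Open Scope group_scope.
Variables (W : groupType) (S : set W).

Definition is_expression (e : seq W) (w : W) : Prop :=
  (forall s, s \in e -> S s) /\ \prod_(s <- e) s = w.

(** The value 0 of a Coxeter matrix stands for infinity; since [x ^+ 0 = 1],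
    the corresponding relation below is vacuous. *)
Definition coxeter_matrix (m : W -> W -> nat) : Prop :=
  forall s t, S s -> S t ->
    [/\ m s s = 1%N, m s t = m t s & s <> t -> m s t <> 1%N].

(** [W] has the presentation [< S | (st)^(m s t) = 1 >]: the relations hold,
    [S] generates [W], and every map from [S] to a group which respects the
    relations extends to a homomorphism.  The elements of [S] are involutions,
    so that generation needs no inverses. *)
Definition presented_by (m : W -> W -> nat) : Prop :=
  [/\ forall s t, S s -> S t -> (s * t) ^+ m s t = 1,
      forall w, exists e, is_expression e w
    & forall (G : groupType) (f : W -> G),
        (forall s t, S s -> S t -> (f s * f t) ^+ m s t = 1) ->
        exists phi : W -> G,
          {morph phi : x y / x * y} /\ (forall s, S s -> phi s = f s)].

Definition coxeter_system : Prop :=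
  exists m, coxeter_matrix m /\ presented_by m.

Definition reduced_expression (e : seq W) (w : W) : Prop :=
  is_expression e w /\ (forall e', is_expression e' w -> size e <= size e')%N.

Definition coxeter_length (w : W) : nat :=
  xget 0%N [set n | exists2 e, reduced_expression e w & size e = n].

Definition right_descents (w : W) : set W :=
  [set s | S s /\ (coxeter_length (w * s) < coxeter_length w)%N].

Definition bruhat_le (u v : W) : Prop :=
  forall e, reduced_expression e v ->
    exists2 e', subseq e' e & \prod_(s <- e') s = u.

Definition coxeter_automorphism (theta : W -> W) : Prop :=
  [/\ {morph theta : x y / x * y}, bijective theta & theta @` S = S].

Definition twisted_identities (theta : W -> W) : set W :=
  range (fun w => theta (w^-1) * w).

Definition twisted_star (theta : W -> W) (w s : W) : W :=
  if theta s * w * s == w then w * s else theta s * w * s.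

End Coxeter.

(** The empty set may be a face.  A complex with no face at all (not even the
    empty one) is allowed: it is distinct from the complex whose only face is
    the empty set. *)
Record simplicial_complex (V : Type) := SimplicialComplex {
  face : set (set V);
  face_finite : forall s, face s -> finite_set s;
  face_subset : forall s t, face s -> t `<=` s -> face t
}.

Section Complexes.
Variable V : Type.

Lemma void_complex_finite (s : set V) : set0 s -> finite_set s.
Proof. by []. Qed.

Lemma void_complex_subset (s t : set V) : set0 s -> t `<=` s -> set0 t.
Proof. by []. Qed.

Definition void_complex : simplicial_complex V :=
  SimplicialComplex void_complex_finite void_complex_subset.

(** The suspension is the join with the complex made of two isolated points,
    here [inr true] and [inr false]. *)
Definition suspension_face (K : simplicial_complex V) : set (set (V + bool)) :=
  [set s | face K (inl @^-1` s) /\ ~ (s (inr true) /\ s (inr false))].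

Lemma suspension_face_finite K s : suspension_face K s -> finite_set s.
Proof.
move=> [/face_finite fs _].
apply: (@sub_finite_set _ _
  (inl @` (inl @^-1` s) `|` inr @` [set: bool])); last first.
  by rewrite finite_setU; split; apply: finite_image.
by move=> [x|b] sx; [left; exists x|right; exists b].
Qed.

Lemma suspension_face_subset K s t :
  suspension_face K s -> t `<=` s -> suspension_face K t.
Proof.
move=> [Ks nps] ts; split; first by apply: face_subset Ks _ => x /= /ts.
by move=> [/ts ? /ts ?]; apply: nps.
Qed.

Definition suspension (K : simplicial_complex V) :
    simplicial_complex (V + bool) :=
  SimplicialComplex (@suspension_face_finite K) (@suspension_face_subset K).

Variables (le : V -> V -> Prop) (P : set V).

Definition order_face (A : set V) : set (set V) :=
  [set s | [/\ finite_set s, s `<=` A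
             & forall x y, s x -> s y -> le x y \/ le y x]].

Lemma order_face_finite A s : order_face A s -> finite_set s.
Proof. by case. Qed.

Lemma order_face_subset A s t : order_face A s -> t `<=` s -> order_face A t.
Proof.
move=> [fs sA cs] ts; split; first exact: sub_finite_set fs.
  exact: subset_trans sA.
by move=> x y /ts sx /ts; apply: cs.
Qed.

Definition order_complex (A : set V) : simplicial_complex V :=
  SimplicialComplex (@order_face_finite A) (@order_face_subset A).

Definition open_interval (a b : V) : set V :=
  [set x | [/\ P x, le a x /\ a <> x & le x b /\ x <> b]].

(** For [a < b] this is the order complex of the open interval.  For [a = b]
    we use the usual convention that the complex of [(a, a)] is the degenerate
    empty complex (the sphere of dimension -2), which has no face at all; its
    suspension is again empty (the sphere of dimension -1), whereas the
    suspension of [order_complex set0 = {{}}] is the sphere of dimension 0. *)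
Definition interval_complex (a b : V) : simplicial_complex V :=
  if `[< le a b /\ a <> b >] then order_complex (open_interval a b)
  else void_complex.

End Complexes.

Section Realization.
Local Open Scope ring_scope.
Variables (R : realType) (V : choiceType) (K : simplicial_complex V).

Definition barycentric : set (V -> R) :=
  [set x | [/\ forall v, 0 <= x v, face K [set v | x v != 0]
             & \sum_(v \in [set: V]) x v = 1]].

Definition realization : Type := {x : V -> R | barycentric x}.

HB.instance Definition _ := gen_eqMixin realization.
HB.instance Definition _ := gen_choiceMixin realization.

Definition closed_simplex (s : set V) : set realization :=
  [set x | [set v | sval x v != 0] `<=` s].

(** Coherent (weak) topology: a set is open if its trace on each closed simplex
    is open in the Euclidean topology of that simplex, which is induced by the
    product topology of [V -> R]. *)
Definition realization_open (U : set realization) : Prop :=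
  forall s, face K s ->
    exists O : set (prod_topology (fun _ : V => R)),
      open O /\
      U `&` closed_simplex s = [set x | O (sval x)] `&` closed_simplex s.

Lemma realization_openT : realization_open setT.
Proof. by move=> s _; exists setT; split => //; exact: openT. Qed.

Lemma realization_openI : setI_closed realization_open.
Proof.
move=> A B oA oB s Ks.
have [OA [oOA EA]] := oA s Ks; have [OB [oOB EB]] := oB s Ks.
exists (OA `&` OB); split; first exact: openI.
by rewrite setIIl EA EB -setIIl.
Qed.

Lemma realization_open_bigcup (I : Type) (U : I -> set realization) :
  (forall i, realization_open (U i)) -> realization_open (\bigcup_i U i).
Proof.
move=> oU s Ks.
have /choice [T hT] : forall i, exists O : set (prod_topology (fun _ : V => R)),
    open O /\
    U i `&` closed_simplex s = [set x | O (sval x)] `&` closed_simplex s.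
  by move=> i; exact: oU.
exists (\bigcup_i T i); split; first by apply: bigcup_open => i _; case: (hT i).
rewrite setI_bigcupl; apply/seteqP; split=> x.
  by move=> [i _]; rewrite (hT i).2 => -[Tx sx]; split => //; exists i.
by move=> [[i _ Tx] sx]; exists i => //; rewrite (hT i).2.
Qed.

HB.instance Definition _ := isOpenTopological.Build realization
  realization_openT realization_openI realization_open_bigcup.

End Realization.

Section Homotopy.
Local Open Scope ring_scope.
Variable R : realType.

Definition homotopic (X Y : topologicalType) (f g : X -> Y) : Prop :=
  exists H : X * R -> Y,
    [/\ {within [set: X] `*` `[0, 1], continuous H},
        forall x, H (x, 0) = f x & forall x, H (x, 1) = g x].

Definition homotopy_equivalent (X Y : topologicalType) : Prop :=
  exists (f : X -> Y) (g : Y -> X),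
    [/\ continuous f, continuous g,
        homotopic (g \o f) idfun & homotopic (f \o g) idfun].

End Homotopy.

(* Main.v *)
(** Write [p = theta s * u * s] and [A = (u, v)].  For a twisted identity [x] let
    [f x = theta s * x * s] if [s] is a right descent of [x], and [f x = x]
    otherwise.  A twisted identity with descent [s] is never fixed by
    [x |-> theta s * x * s], so the lifting property of the Bruhat order, applied
    on the right and (through [x |-> (theta x)^-1]) on the left, shows that [f] is
    monotone.  As [f x = u] only for [x = u, p], [f] maps [A \ {p}] to itself, and
    there [x >= f x <= f v], so that [A \ {p}] is contractible.  Moreover [p] is
    minimal in [A] and its link is [(p, v)].  Hence [A] is, up to homotopy, the
    union of the cone over [(p, v)] with apex [p] and a contractible complex
    containing [(p, v)], which is the suspension of [(p, v)].

    Concretely, let [M] be obtained from the order complex of [A] by erecting a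
    cone over [A \ {p}].  The order complex of [A] is a deformation retract of
    [M], by pushing the new cone along [x >= f x <= f v], and so is the suspension
    of [(p, v)], by pushing the rest of [A \ {p}] to the new cone point.  All the
    maps are given by explicit continuous barycentric coordinates, the complexes
    being finite. *)

Require Import Defs.
From HB Require Import structures.
From mathcomp Require Import all_boot all_order all_algebra.
From mathcomp Require Import all_classical all_reals all_analysis.
From mathcomp Require Import lra.
Import Order.TTheory GRing.Theory Num.Theory.
Import numFieldNormedType.Exports.

Set Implicit Arguments.
Unset Strict Implicit.
Unset Printing Implicit Defensive.

Local Open Scope classical_set_scope.

(** * Realizations of finite complexes *)

Lemma continuous_pairf (X Y Z : topologicalType) (f : X -> Y) (g : X -> Z) :
  continuous f -> continuous g -> continuous (fun x => (f x, g x)).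
Proof.
move=> cf cg x.
by apply: (@cvg_pair _ _ _ _ (nbhs (f x)) (nbhs (g x))); [exact: cf|exact: cg].
Qed.

Section RealFunctions.
Local Open Scope ring_scope.
Variables (R : realType) (X : topologicalType).
Implicit Types f g : X -> R.

Lemma continuous_addf f g :
  continuous f -> continuous g -> continuous (fun x => f x + g x).
Proof. by move=> cf cg x; apply: cvgD; [exact: cf|exact: cg]. Qed.

Lemma continuous_subf f g :
  continuous f -> continuous g -> continuous (fun x => f x - g x).
Proof. by move=> cf cg x; apply: cvgB; [exact: cf|exact: cg]. Qed.

Lemma continuous_mulf f g :
  continuous f -> continuous g -> continuous (fun x => f x * g x).
Proof. by move=> cf cg x; apply: cvgM; [exact: cf|exact: cg]. Qed.

Lemma continuous_maxf f g :
  continuous f -> continuous g -> continuous (fun x => Num.max (f x) (g x)).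
Proof. by move=> cf cg x; apply: continuous_max; [exact: cf|exact: cg]. Qed.

Lemma continuous_minf f g :
  continuous f -> continuous g -> continuous (fun x => Num.min (f x) (g x)).
Proof. by move=> cf cg x; apply: continuous_min; [exact: cf|exact: cg]. Qed.

Lemma continuous_mulrnf n f : continuous f -> continuous (fun x => f x *+ n).
Proof.
move=> cf; rewrite (_ : (fun x => _) = (fun x => f x * n%:R)).
  by apply: continuous_mulf cf _ => x; exact: cvg_cst.
by apply/funext => x; rewrite mulr_natr.
Qed.

Lemma continuous_sumf (I : Type) (r : seq I) (P : pred I) (F : I -> X -> R) :
  (forall i, continuous (F i)) ->
  continuous (fun x => \sum_(i <- r | P i) F i x).
Proof.
move=> cF; apply: continuous_big => [|i _]; last exact: cF.
exact: add_continuous.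
Qed.

End RealFunctions.

Section FiniteComplex.
Local Open Scope ring_scope.
Variables (R : realType) (V : choiceType) (K : simplicial_complex V).
Variable r : seq V.
Hypothesis r_uniq : uniq r.
Hypothesis rK : forall s v, face K s -> s v -> v \in r.

Local Notation "|K|" := (realization R K).

Definition vsupp (x : |K|) : set V := [set v | sval x v != 0].

Lemma realization_eq (x y : |K|) : (forall v, sval x v = sval y v) -> x = y.
Proof. by move: x y => [x px] [y py] /= xy; apply: eq_exist; apply/funext. Qed.

Lemma coord_ge0 (x : |K|) v : 0 <= sval x v.
Proof. by have [] := proj2_sig x. Qed.

Lemma vsupp_face (x : |K|) : face K (vsupp x).
Proof. by have [] := proj2_sig x. Qed.

Lemma coord_out (x : |K|) v : v \notin r -> sval x v = 0.
Proof.
by move=> vr; apply/eqP/negP => /negP xv; move/negP: vr; apply; apply: rK (vsupp_face x) xv.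
Qed.

Lemma sum_coordE (h : V -> R) : (forall v, v \notin r -> h v = 0) ->
  \sum_(v \in [set: V]) h v = \sum_(v <- r) h v.
Proof.
move=> hr; rewrite [RHS]fsbig_seq //.
by rewrite (fsbig_widen [set` r] [set: V]) // => v [_ /= nr]; apply: hr; apply/negP.
Qed.

Lemma sum_coord (x : |K|) : \sum_(v <- r) sval x v = 1.
Proof.
rewrite -sum_coordE; last exact: coord_out.
by have [] := proj2_sig x.
Qed.

Lemma weight_continuous v : continuous (fun x : |K| => sval x v).
Proof.
apply/continuousP => A oA; move=> s Ks.
exists [set y : prod_topology (fun _ : V => R) | A (y v)]; split => //.
have pc : continuous (fun y : prod_topology (fun _ : V => R) => y v).
  exact: (@proj_continuous V (fun=> R : topologicalType) v).
by move/continuousP: pc; apply.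
Qed.

(* As [K] is finite, the coherent topology of [|K|] is the coarsest topology
   making the coordinates continuous. *)
Lemma realization_continuous (X : topologicalType) (F : X -> |K|) :
  (forall v, continuous (fun x => sval (F x) v)) -> continuous F.
Proof.
move=> cF; apply/continuousP => U oU; rewrite openE => x /= Ux.
have cF' : continuous (fun x => sval (F x) : prod_topology (fun _ : V => R)).
  have surj v : [set f v | f in [set: V -> R]] = setT.
    by apply/seteqP; split => // z _; exists (fun=> z).
  move=> y; apply/cvg_sup => v; apply/cvg_image; first exact: surj.
  move=> A /(cF v y) yA; exists ((fun z : V -> R => z v) @^-1` A) => //.
  exact: image_preimage.
change (nbhs x (F @^-1` U)).
(* The support of [F y] is one of the finitely many sets [mask m r], treated one by one. If the set
   contains the support of [F x], openness of [U] on that simplex applies; if not, a nonzero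
   coordinate of [F x] outside it stays nonzero near [x]. *)
have near1 (m : (size r).-tuple bool) : \forall y \near x,
    face K [set` mask m r] -> vsupp (F y) `<=` [set` mask m r] -> U (F y).
  have [Ks|nKs] := pselect (face K [set` mask m r]); last exact: nearW.
  have [B [oB UB]] := oU _ Ks.
  have [xs|/existsNP[v /not_implyP[xv nv]]] := pselect (vsupp (F x) `<=` [set` mask m r]).
    have nB : nbhs x [set y | B (sval (F y))].
      apply: (cF' x B); apply: open_nbhs_nbhs; split => //.
      have : (U `&` closed_simplex [set` mask m r]) (F x) by split.
      by rewrite UB => -[].
    apply: filterS nB => y By _ ys.
    have : (([set x | B (sval x)] : set |K|) `&`
      closed_simplex [set` mask m r]) (F y) by split.
    by rewrite -UB => -[].
  have nz : nbhs x [set y | sval (F y) v != 0].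
    by apply: (cF v x [set z | z != 0]); apply: open_nbhs_nbhs; split => //; exact: open_neq.
  by apply: filterS nz => y yv _ /(_ v yv).
apply: filterS (filter_forall _ near1) => y /= near1y; move: near1y.
have /subseqP[m sm mE] : subseq [seq v <- r | sval (F y) v != 0] r by exact: filter_subseq.
have mP : size m == size r by apply/eqP.
have sE : vsupp (F y) = [set` mask m r].
  rewrite -mE; apply/seteqP; split => v; rewrite /= mem_filter /vsupp /=.
    by move=> yv; rewrite yv /=; apply: rK (vsupp_face (F y)) yv.
  by move=> /andP[].
move=> /(_ (Tuple mP)) /=; rewrite -sE; apply => //.
exact: vsupp_face.
Qed.

(** The weights get divided by their total, so a nonvanishing total suffices; this allows for the
    flow below, which changes the total. *)
Lemma realization_map (X : topologicalType) (h : X -> V -> R) :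
  (forall v, continuous (h ^~ v)) -> (forall x v, 0 <= h x v) ->
  (forall x, face K [set v | h x v != 0]) ->
  (forall x, \sum_(v <- r) h x v != 0) ->
  exists F : X -> |K|, continuous F /\
    forall x v, sval (F x) v = h x v / \sum_(w <- r) h x w.
Proof.
move=> ch h0 hK hn.
have bP x : @barycentric R V K (fun v => h x v / \sum_(w <- r) h x w).
  have s0 : 0 <= \sum_(w <- r) h x w by apply: sumr_ge0.
  have sE : [set v | h x v / \sum_(w <- r) h x w != 0] = [set v | h x v != 0].
    by apply/funext => v /=; rewrite mulf_eq0 invr_eq0 (negPf (hn x)) orbF.
  split; first by move=> v; rewrite divr_ge0.
    by rewrite sE.
  rewrite sum_coordE; last first.
    move=> v vr; have [->|hv] := eqVneq (h x v) 0; first by rewrite mul0r.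
    by move/negP: vr; case; apply: rK (hK x) hv.
  by rewrite -mulr_suml divff.
exists (fun x => exist _ _ (bP x)); split => //.
apply: realization_continuous => v /= x.
apply: cvgM; first exact: ch.
by apply: cvgV => //; apply: (continuous_sumf (F := fun w x => h x w)).
Qed.

End FiniteComplex.

(** * Linear extension of vertex maps *)

Section Pushforward.
Local Open Scope ring_scope.

Lemma sum_delta (R : realType) (V : choiceType) (r : seq V) (x : V -> R) w :
  uniq r -> (w \notin r -> x w = 0) -> \sum_(v <- r) x v *+ (v == w) = x w.
Proof.
move=> ur xw; have [wr|nwr] := boolP (w \in r).
  rewrite (bigD1_seq w) //= eqxx big1 ?addr0 // => v /negPf ->.
  by rewrite mulr0n.
rewrite xw // big_seq big1 // => v vr; have [vw|] := eqVneq v w; last by rewrite mulr0n.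
by move: nwr; rewrite -vw vr.
Qed.

Lemma sum_fixed (R : realType) (V : choiceType) (r : seq V) (x : V -> R)
    (phi : V -> V) w : uniq r -> (forall v, x v != 0 -> v \in r) ->
  (forall v, x v != 0 -> phi v = v) -> \sum_(v <- r) x v *+ (phi v == w) = x w.
Proof.
move=> ur xr xphi; rewrite -[RHS](@sum_delta R V r) //.
  apply: eq_bigr => v _; have [->|/xphi->//] := eqVneq (x v) 0.
  by rewrite !mul0rn.
by move=> nwr; apply/eqP/negP => /negP /xr; apply/negP.
Qed.

Lemma sum_push_neq0 (R : realType) (U V : choiceType) (r : seq U) (x : U -> R)
    (phi : U -> V) v : \sum_(u <- r) x u *+ (phi u == v) != 0 ->
  exists2 u, x u != 0 & phi u = v.
Proof.
move=> xv; have [//|nu] := pselect (exists2 u, x u != 0 & phi u = v).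
case/eqP: xv; apply: big1 => u _; have [->|xu] := eqVneq (x u) 0.
  by rewrite mul0rn.
by have [uv|] := eqVneq (phi u) v; rewrite ?mulr0n //; case: nu; exists u.
Qed.

(** Functoriality of the pushforward: the sum over [r'] regroups the [u] by their value under
    [phi]. *)
Lemma sum_push (R : realType) (U V W : choiceType) (r : seq U) (r' : seq V)
    (x : U -> R) (phi : U -> V) (psi : V -> W) w :
  uniq r' -> (forall u, x u != 0 -> phi u \in r') ->
  \sum_(v <- r') (\sum_(u <- r) x u *+ (phi u == v)) *+ (psi v == w) =
  \sum_(u <- r) x u *+ (psi (phi u) == w).
Proof.
move=> ur xr.
under eq_bigr do rewrite -sumrMnl; rewrite exchange_big; apply: eq_bigr => u _ /=.
have [->|/xr ur'] := eqVneq (x u) 0.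
  by rewrite mul0rn big1 // => v _; rewrite !mul0rn.
rewrite (bigD1_seq (phi u)) //= eqxx big1 ?addr0 // => v vu.
by rewrite eq_sym (negPf vu) mulr0n mul0rn.
Qed.

Variables (R : realType) (V V' : choiceType).
Variables (K : simplicial_complex V) (K' : simplicial_complex V').
Variables (r : seq V) (r' : seq V').
Hypothesis r_uniq : uniq r.
Hypothesis rK : forall s v, face K s -> s v -> v \in r.
Hypothesis r'_uniq : uniq r'.
Hypothesis r'K : forall s v, face K' s -> s v -> v \in r'.

(** Only supports attained by [F] must go to faces, so [phi] may fail to be simplicial on the rest
    of [K], as [retr] may below. *)
Lemma push_map (X : topologicalType) (F : X -> realization R K) (phi : V -> V') :
  continuous F -> (forall x, face K' (phi @` vsupp (F x))) ->
  exists G : X -> realization R K', continuous G /\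
    forall x w, sval (G x) w = \sum_(v <- r) sval (F x) v *+ (phi v == w).
Proof.
move=> cF FK'; pose h x w := \sum_(v <- r) sval (F x) v *+ (phi v == w).
have phir x v : sval (F x) v != 0 -> phi v \in r'.
  by move=> xv; apply: (r'K (FK' x)); exists v.
have hsum x : \sum_(w <- r') h x w = 1.
  rewrite -(sum_coord r_uniq rK (F x)).
  (* The total weight is the pushforward to a one-point set. *)
  transitivity (\sum_(w <- r') h x w *+ (tt == tt)); first exact: eq_bigr.
  rewrite (sum_push r (fun=> tt) tt r'_uniq (phir x)).
  exact: eq_bigr.
have h0 x w : 0 <= h x w.
  by apply: sumr_ge0 => v _; rewrite mulrn_wge0 // coord_ge0.
have [||||G [cG GE]] := @realization_map R V' K' r' r'_uniq r'K X h.
- move=> w; apply: (continuous_sumf (F := fun v x => sval (F x) v *+ (phi v == w))) => v x.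
  apply: continuous_mulrnf => y.
  exact: (continuous_comp (cF y) (@weight_continuous R V K v (F y))).
- exact: h0.
- move=> x; apply: (face_subset (FK' x)) => w /= /sum_push_neq0[v xv <-].
  by exists v.
- by move=> x; rewrite hsum oner_neq0.
by exists G; split => // x w; rewrite GE hsum divr1.
Qed.

End Pushforward.

(** * Homotopies and deformation retracts *)

Section Homotopies.
Local Open Scope ring_scope.
Variable R : realType.

(** Clamping the time gives homotopies continuous on all of [X * R], and not only over [[0, 1]]. *)
Definition clamp (t : R) : R := Num.max 0 (Num.min 1 t).

Lemma clamp_ge0 t : 0 <= clamp t.
Proof. by rewrite /clamp le_max lexx. Qed.

Lemma clamp_le1 t : clamp t <= 1.
Proof. by rewrite /clamp ge_max ler01 ge_min lexx. Qed.

Lemma clamp0 : clamp 0 = 0.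
Proof. by rewrite /clamp min_r ?ler01 // maxxx. Qed.

Lemma clamp1 : clamp 1 = 1.
Proof. by rewrite /clamp minxx max_r // ler01. Qed.

Lemma clamp_continuous (X : topologicalType) :
  continuous (fun x : X * R => clamp x.2).
Proof.
apply: continuous_maxf => [x|]; first exact: cvg_cst.
apply: continuous_minf => x; first exact: cvg_cst.
exact: cvg_snd.
Qed.

Lemma homotopic_comp (X Y Z T : topologicalType) (h : X -> Y) (H : Y * R -> Z)
    (k : Z -> T) :
  continuous h -> continuous k -> continuous H ->
  homotopic R (fun x => k (H (h x, 0))) (fun x => k (H (h x, 1))).
Proof.
move=> ch ck cH; exists (fun x => k (H (h x.1, x.2))); split => //.
apply: continuous_subspaceT => x.
apply: continuous_comp; last exact: ck.
suff ch' : continuous (fun x : X * R => (h x.1, x.2)).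
  by apply: (continuous_comp (ch' x)); exact: cH.
apply: continuous_pairf => [y|y]; last exact: cvg_snd.
exact: (@continuous_comp _ _ _ fst h y cvg_fst (ch y.1)).
Qed.

(** Both [X] and [Y] are deformation retracts of [M]: the composite [g \o G] restricted along [i]
    joins the round trip of [X] to the identity, and [k \o H] restricted along [j] does so for
    [Y]. *)
Lemma homotopy_equivalent_retracts (X Y M : topologicalType)
    (i : X -> M) (g : M -> X) (j : Y -> M) (k : M -> Y) (H G : M * R -> M) :
  continuous i -> continuous g -> continuous j -> continuous k ->
  cancel i g -> cancel j k ->
  continuous H -> (forall y, H (y, 0) = i (g y)) -> (forall y, H (y, 1) = y) ->
  continuous G -> (forall y, G (y, 0) = j (k y)) -> (forall y, G (y, 1) = y) ->
  homotopy_equivalent R X Y.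
Proof.
move=> ci cg cj ck gi kj cH H0 H1 cG G0 G1.
exists (k \o i), (g \o j); split.
- by move=> x; apply: continuous_comp; [exact: ci|exact: ck].
- by move=> x; apply: continuous_comp; [exact: cj|exact: cg].
- have := homotopic_comp ci cg cG; congr homotopic; apply/funext => x /=.
    by rewrite G0.
  by rewrite G1 gi.
- have := homotopic_comp cj ck cH; congr homotopic; apply/funext => x /=.
    by rewrite H0.
  by rewrite H1 kj.
Qed.

End Homotopies.

Section StraightHomotopy.
Local Open Scope ring_scope.
Variables (R : realType) (V : choiceType) (K : simplicial_complex V).
Variable r : seq V.
Hypothesis r_uniq : uniq r.
Hypothesis rK : forall s v, face K s -> s v -> v \in r.

(** At both ends the weights already sum to 1, so normalising leaves them unchanged. *)
Lemma realization_homotopy (X : topologicalType) (h : X * R -> V -> R)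
    (F0 F1 : X -> realization R K) :
  (forall v, continuous (h ^~ v)) -> (forall x v, 0 <= h x v) ->
  (forall x, face K [set v | h x v != 0]) ->
  (forall x, \sum_(v <- r) h x v != 0) ->
  (forall x v, h (x, 0) v = sval (F0 x) v) ->
  (forall x v, h (x, 1) v = sval (F1 x) v) ->
  exists H : X * R -> realization R K,
    [/\ continuous H, forall x, H (x, 0) = F0 x & forall x, H (x, 1) = F1 x].
Proof.
move=> ch h0 hK hn hF0 hF1.
have [H [cH HE]] := realization_map r_uniq rK ch h0 hK hn.
exists H; split=> // x; apply: realization_eq => v; rewrite HE.
  by under eq_bigr do rewrite hF0; rewrite (sum_coord r_uniq rK) divr1 hF0.
by under eq_bigr do rewrite hF1; rewrite (sum_coord r_uniq rK) divr1 hF1.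
Qed.

(** The segment from [F0 x] to [F1 x] stays in the simplex spanned by the two supports. *)
Lemma straight_homotopy (X : topologicalType) (F0 F1 : X -> realization R K) :
  continuous F0 -> continuous F1 ->
  (forall x, face K (vsupp (F0 x) `|` vsupp (F1 x))) ->
  exists H : X * R -> realization R K,
    [/\ continuous H, forall x, H (x, 0) = F0 x & forall x, H (x, 1) = F1 x].
Proof.
move=> c0 c1 F01.
pose h (x : X * R) v :=
  (1 - clamp x.2) * sval (F0 x.1) v + clamp x.2 * sval (F1 x.1) v.
have ccoord (F : X -> realization R K) v :
    continuous F -> continuous (fun x : X * R => sval (F x.1) v).
  move=> cF; have cFv : continuous (fun y => sval (F y) v).
    by move=> y; exact: (continuous_comp (cF y) (@weight_continuous R V K v (F y))).
  by move=> x; exact: (@continuous_comp _ _ _ fst _ x cvg_fst (cFv x.1)).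
apply: (@realization_homotopy _ h); rewrite /h.
- move=> v; apply: continuous_addf; apply: continuous_mulf; try exact: ccoord.
    by apply: continuous_subf => [x|]; [exact: cvg_cst|exact: clamp_continuous].
  exact: clamp_continuous.
- move=> x v; rewrite addr_ge0 // mulr_ge0 ?coord_ge0 ?clamp_ge0 //.
  by rewrite subr_ge0 clamp_le1.
- move=> x; apply: (face_subset (F01 x.1)) => v /=.
  have [F0v|F0v] := eqVneq (sval (F0 x.1) v) 0; last by left.
  have [F1v|F1v] := eqVneq (sval (F1 x.1) v) 0; last by right.
  by rewrite F0v F1v !mulr0 addr0 eqxx.
- move=> x; rewrite big_split /= -!mulr_sumr !(sum_coord r_uniq rK) !mulr1.
  by rewrite subrK oner_neq0.
- by move=> x v /=; rewrite clamp0 subr0 mul1r mul0r addr0.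
- by move=> x v /=; rewrite clamp1 subrr mul0r mul1r add0r.
Qed.

End StraightHomotopy.

(** * Removing a minimal element with contractible complement *)

Section PosetSuspension.
Local Open Scope ring_scope.
Variables (R : realType) (V : choiceType) (le : V -> V -> Prop).
Hypothesis le_refl : forall x, le x x.
Hypothesis le_trans : forall x y z, le x y -> le y z -> le x z.
Hypothesis le_antisym : forall x y, le x y -> le y x -> x = y.
Variables (A : set V) (p c : V) (f : V -> V) (r : seq V).
Hypothesis r_uniq : uniq r.
Hypothesis rA : forall v, A v -> v \in r.
Hypothesis Ap : A p.
Hypothesis p_min : forall x, A x -> le x p -> x = p.
Hypothesis Ac : A c.
Hypothesis cp : c <> p.
Hypothesis fP : forall x, A x -> x <> p ->
  [/\ A (f x), f x <> p, le (f x) x & le (f x) c].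
Hypothesis f_mono : forall x y, A x -> x <> p -> A y -> y <> p ->
  le x y -> le (f x) (f y).

Let Q := [set x | A x /\ x <> p].
Let L := [set x | [/\ A x, le p x & x <> p]].

(* The order complex of [A] with a cone of apex [inr false] erected over the
   subcomplex of [Q]; the vertex [p] is renamed [inr true]. *)
Definition coned_face : set (set (V + bool)) :=
  [set s | [/\ order_face le Q (inl @^-1` s),
     ~ (s (inr true) /\ s (inr false))
   & s (inr true) -> forall v, s (inl v) -> le p v]].

Lemma coned_face_finite s : coned_face s -> finite_set s.
Proof.
move=> [[fs _ _] _ _].
apply: (@sub_finite_set _ _
  (inl @` (inl @^-1` s) `|` inr @` [set: bool])); last first.
  by rewrite finite_setU; split; apply: finite_image.
by move=> [x|b] sx; [left; exists x|right; exists b].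
Qed.

Lemma coned_face_subset s t : coned_face s -> t `<=` s -> coned_face t.
Proof.
move=> [Qs nps ps] ts; split; first by apply: order_face_subset Qs _ => x /= /ts.
  by move=> [/ts ? /ts ?]; apply: nps.
by move=> /ts /ps pv v /ts /pv.
Qed.

Definition coned : simplicial_complex (V + bool) :=
  SimplicialComplex coned_face_finite coned_face_subset.

Let K := order_complex le A.
Let Y := suspension (order_complex le L).
Let rM : seq (V + bool) := [seq inl v | v <- r] ++ [:: inr true; inr false].

Lemma rM_uniq : uniq rM.
Proof.
have nin (b : bool) : ((inr b : V + bool) \in [seq inl v | v <- r]) = false.
  by apply/negbTE/mapP => -[].
rewrite cat_uniq map_inj_uniq; last by move=> x y [].
by rewrite r_uniq /= !nin.
Qed.

Lemma mem_rM_inr b : inr b \in rM.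
Proof. by rewrite mem_cat !inE; case: b; rewrite eqxx !orbT. Qed.

Lemma mem_rM_inl v : v \in r -> inl v \in rM.
Proof. by move=> vr; rewrite mem_cat map_f. Qed.

Lemma rK s v : face K s -> s v -> v \in r.
Proof. by move=> [_ sA _] /sA; exact: rA. Qed.

Lemma rcone s v : face coned s -> s v -> v \in rM.
Proof.
case: v => [v|b]; last by rewrite mem_rM_inr.
by move=> [[_ sQ _] _ _] sv; apply/mem_rM_inl/rA; have [] := sQ _ sv.
Qed.

Lemma rY s v : face Y s -> s v -> v \in rM.
Proof.
case: v => [v|b]; last by rewrite mem_rM_inr.
by move=> [[_ sL _] _] sv; apply/mem_rM_inl/rA; have [] := sL _ sv.
Qed.

(** * Vertex maps between the three complexes *)

Let phi (v : V) : V + bool := if `[< v = p >] then inr true else inl v.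
(** At the cone point [inr false] the value [p] is a default; [retr] is applied to faces avoiding
    that point. *)
Let retr (w : V + bool) : V := if w is inl v then v else p.
Let psi (w : V + bool) : V + bool :=
  if w is inl v then (if `[< L v >] then inl v else inr false) else w.

Lemma phi_face s : face K s -> face coned (phi @` s).
Proof.
move=> [fs sA cs].
have phil v : (phi @` s) (inl v) -> s v /\ v <> p.
  by move=> [u su]; rewrite /phi; case: asboolP => // up [<-].
split.
- split.
  + by apply: (@sub_finite_set _ _ s) => // v /phil[].
  + by move=> v /phil[/sA].
  + by move=> x y /phil[sx _] /phil[sy _]; apply: cs.
- by move=> [_ [u _]]; rewrite /phi; case: asboolP.
- move=> [u su]; rewrite /phi; case: asboolP => // up _ v /phil[sv vp].
  rewrite up in su; have [//|vlep] := cs _ _ su sv.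
  by case: vp; apply: p_min => //; apply: sA.
Qed.

Lemma retr_face s : face coned s -> ~ s (inr false) -> face K (retr @` s).
Proof.
move=> fcs ns; have [[fs sQ cs] _ ps] := fcs.
split.
- by apply: finite_image; apply: coned_face_finite.
- by move=> _ [[v|b] sv <-]; [have [] := sQ _ sv|exact: Ap].
- move=> _ _ [[x|[]] sx <-] [[y|[]] sy <-] //=.
  + exact: (cs _ _ sx sy).
  + by right; apply: (ps sy).
  + by left; apply: (ps sx).
  + by left.
Qed.

Lemma coned_L s v : face coned s -> s (inr true) -> s (inl v) -> L v.
Proof. by move=> [[_ sQ _] _ ps] st sv; have [? ?] := sQ _ sv; split=> //; apply: ps. Qed.

Lemma psi_face s : face coned s -> face Y (psi @` s).
Proof.
move=> fs; have [[fin sQ cs] nps ps] := fs.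
have psil v : (psi @` s) (inl v) -> s (inl v) /\ L v.
  by move=> [[u|b] su] //=; case: asboolP => // Lu [<-].
split.
  split.
  - by apply: (@sub_finite_set _ _ (inl @^-1` s)) => // v /psil[].
  - by move=> v /psil[].
  - by move=> x y /psil[sx _] /psil[sy _]; apply: cs.
move=> [[[u|b] su]]; first by rewrite /=; case: asboolP.
case=> bE; rewrite bE in su => -[[v|b'] sv] /=.
  by case: asboolP => // nL _; apply: nL; apply: coned_L su sv.
by case=> b'E; rewrite b'E in sv; apply: nps.
Qed.

(** Contiguity of [psi] and the identity: [psi] adds the cone point only when some vertex lies
    outside [L], and by [coned_L] such a face does not contain [inr true]. *)
Lemma psi_face_union s : face coned s -> face coned (psi @` s `|` s).
Proof.
move=> fs; have [[fin sQ cs] nps ps] := fs.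
have psil v : (psi @` s `|` s) (inl v) -> s (inl v).
  by case=> // -[[u|b] su] //=; case: asboolP => // Lu [<-].
have psit : (psi @` s `|` s) (inr true) -> s (inr true).
  by case=> // -[[u|b] su] /=; [case: asboolP|case=> <-].
split.
- split.
  + by apply: (@sub_finite_set _ _ (inl @^-1` s)) => // v /psil.
  + by move=> v /psil/sQ.
  + by move=> x y /psil sx /psil sy; apply: cs.
- move=> [/psit st] [[[u|b] su] /=|sf]; last exact: nps.
    by case: asboolP => // nL _; apply: nL; apply: coned_L st su.
  by case=> bE; rewrite bE in su; apply: nps.
- by move=> /psit st v /psil; apply: ps.
Qed.

Lemma Y_coned s : face Y s -> face coned s.
Proof.
move=> [[fin sL cs] nps]; split=> //; last by move=> _ v /sL[].
by split=> // v /sL[].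
Qed.

Local Notation "|M|" := (realization R coned).

(** Here [j] is the inclusion and [k] the linear extension of [psi]; contiguity provides the
    straight homotopy. *)
Lemma suspension_retract : exists (j : realization R Y -> |M|)
    (k : |M| -> realization R Y) (G : |M| * R -> |M|),
  [/\ continuous j, continuous k, cancel j k &
   [/\ continuous G, forall y, G (y, 0) = j (k y) & forall y, G (y, 1) = y]].
Proof.
have cid (X : topologicalType) : continuous (@id X) by move=> x; exact: cvg_id.
have [|j [cj jE]] := push_map rM_uniq rY rM_uniq rcone (F := id) (phi := id)
    (@cid (realization R Y)).
  by move=> x; rewrite image_id; apply/Y_coned/vsupp_face.
have [|k [ck kE]] := push_map rM_uniq rcone rM_uniq rY (F := id) (phi := psi) (@cid |M|).
  by move=> x; apply/psi_face/vsupp_face.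
have jE' x w : sval (j x) w = sval x w.
  rewrite jE (sum_fixed _ rM_uniq) // => v xv; exact: rY (vsupp_face x) xv.
have jk : continuous (j \o k).
  by move=> x; apply: continuous_comp; [exact: ck|exact: cj].
have [x|G [cG G0 G1]] := straight_homotopy rM_uniq rcone jk (@cid |M|).
  apply: (face_subset (psi_face_union (vsupp_face x))) => w [|]; last by right.
  by rewrite /vsupp /= jE' kE => /sum_push_neq0[v xv <-]; left; exists v.
exists j, k, G; split=> // x; apply: realization_eq => w; rewrite kE.
under eq_bigr do rewrite jE'.
rewrite (sum_fixed _ rM_uniq) // => v xv; first exact: rY (vsupp_face x) xv.
have [[_ sL _] _] := vsupp_face x.
by case: v xv => //= v xv; rewrite asboolT //; apply: sL.
Qed.

(** * The flow that empties the cone point *)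

Let below (y : V + bool -> R) v : R :=
  \sum_(u <- r | `[< le u v /\ u <> v >]) y (inl u).

(** Stack the weights of a chain from the bottom, so that [v] occupies the interval from [below y v]
    to [below y v + y (inl v)]; this is the length of the part of it under level [e]. *)
Let moved (y : V + bool -> R) (e : R) v : R :=
  Num.max 0 (Num.min (y (inl v)) (e - below y v)).

Section Moved.
Variables (y : V + bool -> R).
Hypothesis y0 : forall w, 0 <= y w.
Hypothesis yr : forall v, v \notin r -> y (inl v) = 0.

(** The sums are compared termwise: whatever is strictly below [u] is strictly below [v], while [u]
    itself counts only in [below y v]. *)
Lemma below_lt u v : le u v -> u <> v -> below y u + y (inl u) <= below y v.
Proof.
move=> uv nuv; rewrite /below !(big_mkcond (fun w => `[< _ >])) /=.
rewrite -[y (inl u)](sum_delta (x := fun u => y (inl u)) r_uniq (@yr u)).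
rewrite -big_split /=; apply: ler_sum => w _.
have [->|wu] := eqVneq w u.
  by rewrite asboolF => [|[]//]; rewrite asboolT // add0r.
rewrite mulr0n addr0; case: asboolP => [[wleu _]|_]; last by case: ifP.
rewrite asboolT //; split; first exact: le_trans uv.
by move=> wv; rewrite wv in wleu; apply: nuv; apply: le_antisym.
Qed.

Lemma below_le v : below y v + y (inl v) <= \sum_(u <- r) y (inl u).
Proof.
rewrite /below (big_mkcond (fun w => `[< _ >])) /=.
rewrite -[y (inl v)](sum_delta (x := fun u => y (inl u)) r_uniq (@yr v)).
rewrite -big_split /=; apply: ler_sum => w _.
have [->|wv] := eqVneq w v; first by rewrite asboolF => [|[]//]; rewrite add0r.
by rewrite mulr0n addr0; case: ifP.
Qed.

Lemma below_ge0 v : 0 <= below y v.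
Proof. by apply: sumr_ge0 => u _. Qed.

Lemma moved_ge0 e v : 0 <= moved y e v.
Proof. by rewrite /moved le_max lexx. Qed.

Lemma moved_le e v : moved y e v <= y (inl v).
Proof. by rewrite /moved ge_max y0 ge_min lexx. Qed.

Lemma moved0 v : moved y 0 v = 0.
Proof.
by rewrite /moved max_l // ge_min sub0r oppr_le0 below_ge0 orbT.
Qed.

Lemma moved_neq0 e v : moved y e v != 0 -> below y v < e /\ y (inl v) != 0.
Proof.
rewrite /moved => m0; split.
  rewrite ltNge; apply: contra m0 => eb.
  by rewrite max_l // ge_min subr_le0 eb orbT.
apply: contra m0 => /eqP ->; rewrite max_l // ge_min lexx //.
Qed.

Lemma unmoved_neq0 e v : y (inl v) - moved y e v != 0 ->
  e < below y v + y (inl v) /\ y (inl v) != 0.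
Proof.
move=> m0; split; last first.
  apply: contra m0 => /eqP yv; rewrite yv sub0r oppr_eq0.
  by rewrite eq_le moved_ge0 -{1}yv moved_le.
rewrite ltNge; apply: contra m0 => eb.
by rewrite /moved min_l ?lerBrDl // max_r // subrr.
Qed.

(* If mass has started to leave [v] while some is left at [u], then [v <= u]:
   hence the images of the moved points and the points left form a chain. *)
Lemma moved_unmoved e u v : le u v \/ le v u ->
  y (inl u) - moved y e u != 0 -> moved y e v != 0 -> le v u.
Proof.
move=> uv /unmoved_neq0[eu _] /moved_neq0[ev _].
have [<-//|nuv] := pselect (u = v); case: uv => // uv.
have := below_lt uv nuv; have := lt_trans ev eu.
by rewrite ltNge => /negP.
Qed.

End Moved.

(* [flow (_, 1)] is the identity.  As the second coordinate decreases to [0], the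
   mass [z] of the cone point is taken away; meanwhile mass is moved along [f],
   starting from the bottom of the chain, up to an amount [e], and [c] receives
   mass only once [e > 1], when everything outside the cone point has been moved
   below [c].  Points of [A] ([z = 0]) stay fixed.  The total weight is not
   preserved, so the result has to be normalised. *)
Let flow (x : |M| * R) (w : V + bool) : R :=
  let y := sval x.1 in let t := 1 - clamp x.2 in
  let e := 2 * (y (inr false) * t) in
  match w with
  | inl v => (y (inl v) - moved y e v) +
      \sum_(u <- r) moved y e u *+ (f u == v) + Num.max 0 (e - 1) *+ (c == v)
  | inr true => y (inr true)
  | inr false => y (inr false) - y (inr false) * t
  end.

Lemma flow_continuous w : continuous (flow ^~ w).
Proof.
have cy w' : continuous (fun x : |M| * R => sval x.1 w').
  move=> x; apply: (@continuous_comp _ _ _ fst (fun y : |M| => sval y w')).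
    exact: cvg_fst.
  exact: weight_continuous.
have cc (a : R) : continuous (fun x : |M| * R => a) by move=> x; exact: cvg_cst.
have ct : continuous (fun x : |M| * R => 1 - clamp x.2).
  by apply: continuous_subf => //; exact: clamp_continuous.
have czt := continuous_mulf (cy (inr false)) ct.
have ce : continuous (fun x : |M| * R => 2 * (sval x.1 (inr false) * (1 - clamp x.2))).
  exact: continuous_mulf.
have cm v : continuous (fun x : |M| * R =>
    moved (sval x.1) (2 * (sval x.1 (inr false) * (1 - clamp x.2))) v).
  apply: continuous_maxf => //; apply: continuous_minf => //.
  apply: continuous_subf => //.
  apply: (continuous_sumf (F := fun u (x : |M| * R) => sval x.1 (inl u))) => u; exact: cy.
case: w => [v|[]]; rewrite /flow; first 1 last.
- exact: cy.
- exact: continuous_subf.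
apply: continuous_addf; last first.
  by apply: continuous_mulrnf; apply: continuous_maxf => //; apply: continuous_subf.
apply: continuous_addf; first exact: continuous_subf.
apply: continuous_sumf => u; exact: continuous_mulrnf.
Qed.

Section FlowAt.
Variable x : |M| * R.

Let y := sval x.1.
Let t := 1 - clamp x.2.
Let e := 2 * (y (inr false) * t).

Lemma flow_t : 0 <= t <= 1.
Proof. by have := clamp_ge0 x.2; have := clamp_le1 x.2; rewrite /t; lra. Qed.

Lemma cone_ge0 w : 0 <= y w. Proof. exact: coord_ge0. Qed.

Lemma cone_out v : v \notin r -> y (inl v) = 0.
Proof.
move=> vr; apply: (coord_out rcone); rewrite mem_cat !inE /= orbF.
by apply/mapP => -[u ur [uv]]; rewrite uv ur in vr.
Qed.

Lemma cone_sum : \sum_(u <- r) y (inl u) + y (inr true) + y (inr false) = 1.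
Proof.
rewrite -(sum_coord rM_uniq rcone x.1) big_cat big_map /= !big_cons big_nil.
by rewrite addr0 addrA.
Qed.

(** Nothing moves at [e = 0]. The hypothesis covers time [1], where [t = 0], as well as points
    without weight at the cone point. *)
Lemma flow_id : y (inr false) * t = 0 -> forall w, flow x w = y w.
Proof.
move=> zt [v|[]] //; rewrite /flow -/y -/t zt; last by rewrite subr0.
rewrite mulr0 !moved0 //; try exact: cone_ge0.
rewrite subr0 max_l ?mul0rn ?addr0; last by lra.
by rewrite big1 ?addr0 // => u _; rewrite moved0 ?mul0rn //; exact: cone_ge0.
Qed.

Lemma flow_inl v : flow x (inl v) != 0 ->
  [\/ y (inl v) - moved y e v != 0,
      exists2 u, moved y e u != 0 & f u = v
    | 1 < e /\ v = c].
Proof.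
rewrite /flow -/y -/t -/e => hv.
have [m1|m1] := eqVneq (y (inl v) - moved y e v) 0; last by constructor 1.
have [m2|m2] := eqVneq (\sum_(u <- r) moved y e u *+ (f u == v)) 0; last first.
  by constructor 2; exact: sum_push_neq0 m2.
constructor 3; move: hv; rewrite m1 m2 !add0r.
have [cv|] := eqVneq c v; last by rewrite mulr0n eqxx.
have [e1|e1 _] := leP e 1; last by [].
by rewrite max_l ?mul0rn ?eqxx // subr_le0.
Qed.

Lemma flow_ge0 w : 0 <= flow x w.
Proof.
have /andP[t0 t1] := flow_t; have y0 := cone_ge0.
case: w => [v|[]]; rewrite /flow -/y -/t -/e; last 2 first.
- exact: y0.
- by rewrite subr_ge0 ler_piMr.
apply: addr_ge0; last by rewrite mulrn_wge0 // le_max lexx.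
apply: addr_ge0; first by rewrite subr_ge0 moved_le.
by apply: sumr_ge0 => u _; rewrite mulrn_wge0 // moved_ge0.
Qed.

(** The images under [f] of vertices being emptied form a chain by monotonicity, lie below the
    vertices not yet emptied by [moved_unmoved], and lie below [c]. Extra weight is put at [c] only
    once all vertices are emptied. *)
Lemma flow_face : face coned [set w | flow x w != 0].
Proof.
have [[fin sQ cs] nps ps] := vsupp_face x.1.
have y0 := cone_ge0; have yr := cone_out.
have yQ v : y (inl v) != 0 -> A v /\ v <> p by move=> yv; exact: sQ.
have mQ u : moved y e u != 0 -> [/\ y (inl u) != 0, A u & u <> p].
  by move=> /moved_neq0[_ yu]; have [] := yQ _ yu.
have uQ u : y (inl u) - moved y e u != 0 -> [/\ y (inl u) != 0, A u & u <> p].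
  by move=> /(unmoved_neq0 y0)[_ yu]; have [] := yQ _ yu.
have flowQ v : flow x (inl v) != 0 -> A v /\ v <> p.
  move=> /flow_inl[/uQ[]//|[u /mQ[_ Au up] <-]|[_ ->]] //.
  by have [] := fP Au up.
(* The weight outside the cone point is at most 1, so a level above 1 has emptied every vertex. *)
have full u : 1 < e -> y (inl u) - moved y e u = 0.
  move=> e1; apply/eqP/negP => /negP /(unmoved_neq0 y0)[eu _].
  have := below_le y0 yr u; have := cone_sum.
  by have := y0 (inr true); have := y0 (inr false); move: eu e1; lra.
have f_un a b : y (inl a) - moved y e a != 0 -> moved y e b != 0 -> le (f b) a.
  move=> ua mb; have [ya _ _] := uQ _ ua; have [yb Ab bp] := mQ _ mb.
  have [_ _ fb _] := fP Ab bp; apply: le_trans fb _.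
  exact: (moved_unmoved y0 yr (cs _ _ ya yb) ua mb).
have f_c b : moved y e b != 0 -> le (f b) c.
  by move=> /mQ[_ Ab bp]; have [] := fP Ab bp.
split.
- split.
  + apply: (@sub_finite_set _ _ [set` r]); last exact: finite_seq.
    by move=> v /flowQ[Av _]; exact: rA.
  + by move=> v /flowQ.
  + move=> a b /flow_inl[ua|[a' ma <-]|[e1 ->]] /flow_inl[ub|[b' mb <-]|[e1' ->]].
    * by have [ya _ _] := uQ _ ua; have [yb _ _] := uQ _ ub; exact: cs.
    * by right; exact: f_un.
    * by case/eqP: ua; exact: full.
    * by left; exact: f_un.
    * have [ya Aa ap] := mQ _ ma; have [yb Ab bp] := mQ _ mb.
      by have [ab|ba] := cs _ _ ya yb; [left|right]; apply: f_mono.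
    * by left; exact: f_c.
    * by case/eqP: ub; exact: full.
    * by right; exact: f_c.
    * by left.
- rewrite /flow /= -/y -/t => -[yt zt]; apply: nps; split=> //.
  by rewrite /vsupp /= -/y; apply: contra zt => /eqP ->; rewrite mul0r subr0.
(* A face containing [inr true] avoids the cone point, so the flow is stationary there. *)
- move=> yt v; have z0 : y (inr false) = 0 by apply/eqP/negP => /negP yf; apply: nps.
  change (flow x (inl v) != 0 -> le p v); rewrite flow_id; first exact: ps.
  by rewrite z0 mul0r.
Qed.

(** Weight at some [v] remains partly at [v] or has wholly arrived at [f v], and weight at
    [inr true] never changes. This leaves the cone point itself. *)
Lemma flow_neq0 : \sum_(w <- rM) flow x w != 0.
Proof.
have y0 := cone_ge0; have yr := cone_out; have [[_ sQ _] _ _] := vsupp_face x.1.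
suff [w hw] : exists w, 0 < flow x w.
  have wr : w \in rM by apply: (rcone flow_face); rewrite /= gt_eqF.
  rewrite gt_eqF // (bigD1_seq w) //=; last exact: rM_uniq.
  by rewrite ltr_wpDr // sumr_ge0 // => w' _; exact: flow_ge0.
have sum_ge0 v : 0 <= \sum_(u <- r) moved y e u *+ (f u == v).
  by apply: sumr_ge0 => u _; rewrite mulrn_wge0 // moved_ge0.
have max_ge0 v : 0 <= Num.max 0 (e - 1) *+ (c == v).
  by rewrite mulrn_wge0 // le_max lexx.
have [[v yv]|ny] := pselect (exists v, y (inl v) != 0).
  have vr : v \in r by apply: rA; have [] := sQ _ yv.
  have [mv|mv] := eqVneq (moved y e v) (y (inl v)).
    exists (inl (f v)); rewrite /flow -/y -/t -/e ltr_wpDr // ltr_wpDl //.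
      by rewrite subr_ge0 moved_le.
    rewrite (bigD1_seq v) //= eqxx mv ltr_wpDr //.
      by apply: sumr_ge0 => u _; rewrite mulrn_wge0 // moved_ge0.
    by rewrite lt_def yv y0.
  exists (inl v); rewrite /flow -/y -/t -/e.
  apply: ltr_wpDr; first exact: max_ge0.
  apply: ltr_wpDr; first exact: sum_ge0.
  by rewrite subr_gt0 lt_def eq_sym mv moved_le.
have ny' v : y (inl v) = 0 by apply/eqP/negP => /negP yv; apply: ny; exists v.
have := cone_sum; rewrite big1 // add0r => y1.
have [yt|yt] := eqVneq (y (inr true)) 0; last first.
  by exists (inr true); rewrite /flow -/y lt_def yt y0.
have z1 : y (inr false) = 1 by rewrite -y1 yt add0r.
(* For [t < 1] the cone point keeps some weight; for [t = 1] the factor 2 gives [e = 2], so [c] has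
   received [e - 1 = 1]. *)
have [t1|t1] := eqVneq t 1; last first.
  exists (inr false); rewrite /flow -/y -/t z1 mul1r subr_gt0 lt_def eq_sym t1.
  by have /andP[] := flow_t.
exists (inl c); rewrite /flow -/y -/t -/e ltr_wpDl //.
  by rewrite addr_ge0 // subr_ge0 moved_le.
by rewrite eqxx /e z1 t1 lt_max; apply/orP; right; lra.
Qed.

End FlowAt.

(** Here [g] is the flow at time [0], which leaves no weight at the cone point, followed by renaming
    [inr true] to [p]. The flow fixes the image of [i], whence [cancel i g]. *)
Lemma interval_retract : exists (i : realization R K -> |M|)
    (g : |M| -> realization R K) (H : |M| * R -> |M|),
  [/\ continuous i, continuous g, cancel i g &
   [/\ continuous H, forall y, H (y, 0) = i (g y) & forall y, H (y, 1) = y]].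
Proof.
have cid (X : topologicalType) : continuous (@id X) by move=> x; exact: cvg_id.
have [H [cH HE]] := realization_map rM_uniq rcone flow_continuous flow_ge0
  flow_face flow_neq0.
have Hid y t : sval y (inr false) * (1 - clamp t) = 0 -> H (y, t) = y.
  move=> zt; apply: realization_eq => w; rewrite HE.
  under eq_bigr do rewrite flow_id //.
  by rewrite (sum_coord rM_uniq rcone) divr1 flow_id.
have [|i [ci iE]] := push_map r_uniq rK rM_uniq rcone (F := id) (phi := phi)
    (@cid (realization R K)).
  by move=> x; apply/phi_face/vsupp_face.
have cH0 : continuous (fun y : |M| => H (y, 0)).
  have cp0 : continuous (fun y : |M| => (y, 0 : R)).
    apply: continuous_pairf => y; first exact: cvg_id.
    exact: (@cst_continuous |M| R 0).
  by move=> y; apply: (continuous_comp (cp0 y)); exact: cH.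
have Hcone y : sval (H (y, 0)) (inr false) = 0.
  by rewrite HE /flow /= clamp0 subr0 mulr1 subrr mul0r.
have [|g [cg gE]] := push_map rM_uniq rcone r_uniq rK (phi := retr) cH0.
  by move=> y; apply: retr_face; [exact: vsupp_face|rewrite /vsupp /= Hcone eqxx].
exists i, g, H; split=> //.
- move=> x; apply: realization_eq => v; rewrite gE Hid; last first.
    rewrite iE big1 ?mul0r // => u _.
    by rewrite /phi; case: asboolP => _; rewrite mulr0n.
  under eq_bigr do rewrite iE.
  rewrite (sum_push _ _ _ rM_uniq) => [|u xu].
    apply: sum_fixed => // u xu; first exact: rK (vsupp_face x) xu.
    by rewrite /phi; case: asboolP.
  apply: (rcone (phi_face (vsupp_face x))); by exists u.
- split=> // y; last first.
    by apply: Hid; rewrite clamp1 subrr mulr0.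
  apply/esym/realization_eq => w; rewrite iE; under eq_bigr do rewrite gE.
  have fH := vsupp_face (H (y, 0)).
  rewrite (sum_push _ _ _ r_uniq) => [|w' xw'].
    apply: sum_fixed => [|w' xw'|[v|[]] xw' /=]; first exact: rM_uniq.
    + exact: rcone fH xw'.
    + rewrite /phi; case: asboolP => // vp.
      by have [[_ sQ _] _ _] := fH; have [_] := sQ _ xw'.
    + by rewrite /phi asboolT.
    + by rewrite Hcone eqxx in xw'.
  apply: (rK (retr_face fH _)); first by rewrite /vsupp /= Hcone eqxx.
  by exists w'.
Qed.

Theorem poset_suspension : homotopy_equivalent R (realization R K) (realization R Y).
Proof.
have [i [g [H [ci cg gi [cH H0 H1]]]]] := interval_retract.
have [j [k [G [cj ck kj [cG G0 G1]]]]] := suspension_retract.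
exact: homotopy_equivalent_retracts ci cg cj ck gi kj cH H0 H1 cG G0 G1.
Qed.

End PosetSuspension.

(** * Coxeter groups and twisted identities *)

Section Wreath.
Local Open Scope group_scope.
Variable W : groupType.

(* A homomorphism [W -> wreath] lifting the identity of [W] is a cocycle with
   values in [W -> bool], where [W] acts by conjugation of the argument. *)
Definition wreath : Type := ((W -> bool) * W)%type.

HB.instance Definition _ := gen_eqMixin wreath.
HB.instance Definition _ := gen_choiceMixin wreath.

Definition wreath_mul (x y : wreath) : wreath :=
  (fun t => y.1 t (+) x.1 (y.2 * t * y.2^-1), x.2 * y.2).

Definition wreath_one : wreath := (fun=> false, 1).

Definition wreath_inv (x : wreath) : wreath :=
  (fun t => x.1 (x.2^-1 * t * x.2), x.2^-1).

Lemma wreath_mulA : associative wreath_mul.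
Proof.
move=> [f x] [g y] [h z]; congr (_, _) => /=; last exact: mulgA.
by apply/funext => t; rewrite addbA invgM !mulgA.
Qed.

Lemma wreath_mul1 : left_id wreath_one wreath_mul.
Proof.
move=> [f x]; congr (_, _) => /=; last exact: mul1g.
by apply/funext => t; rewrite addbF.
Qed.

Lemma wreath_mulr1 : right_id wreath_one wreath_mul.
Proof.
move=> [f x]; congr (_, _) => /=; last exact: mulg1.
by apply/funext => t; rewrite invg1 mulg1 mul1g.
Qed.

Lemma wreath_mulV : left_inverse wreath_one wreath_inv wreath_mul.
Proof.
move=> [f x]; congr (_, _) => /=; last exact: mulVg.
by apply/funext => t; rewrite !mulgA mulVg mul1g mulgVK addbb.
Qed.

Lemma wreath_mulrV : right_inverse wreath_one wreath_inv wreath_mul.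
Proof.
move=> [f x]; congr (_, _) => /=; last exact: mulgV.
by apply/funext => t; rewrite invgK addbb.
Qed.

HB.instance Definition _ := isGroup.Build wreath
  wreath_mulA wreath_mul1 wreath_mulr1 wreath_mulV wreath_mulrV.

Lemma wreathM (x y : wreath) :
  x * y = (fun t => y.1 t (+) x.1 (y.2 * t * y.2^-1), x.2 * y.2).
Proof. by []. Qed.

Lemma wreathX (x : wreath) n :
  x ^+ n = (fun t => \big[addb/false]_(i < n) x.1 (x.2 ^+ i * t * x.2 ^- i),
            x.2 ^+ n).
Proof.
elim: n => [|n IHn].
  by rewrite !expg0; congr (_, _); apply/funext => t; rewrite big_ord0.
rewrite expgS IHn wreathM /=; congr (_, _); last by rewrite expgS.
by apply/funext => t; rewrite big_ord_recr.
Qed.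

End Wreath.

(** * The reflection cocycle, strong exchange and the Bruhat order *)

Section CoxeterGroup.
Local Open Scope group_scope.
Variables (W : groupType) (S : set W).
Hypothesis coxS : coxeter_system S.

Lemma gen_sq s : S s -> s * s = 1.
Proof.
have [m [mS [relS _ _]]] := coxS => Ss.
by have := relS s s Ss Ss; have [-> _ _] := mS s s Ss Ss; rewrite expg1.
Qed.

Lemma gen_inv s : S s -> s^-1 = s.
Proof. by move=> Ss; apply: (mulgI s); rewrite mulgV gen_sq. Qed.

Lemma gen_mulK s w : S s -> w * s * s = w.
Proof. by move=> Ss; rewrite -mulgA gen_sq // mulg1. Qed.

Lemma gen_mulVK s w : S s -> s * (s * w) = w.
Proof. by move=> Ss; rewrite mulgA gen_sq // mul1g. Qed.

(** Conjugation by [t] inverts [d = s * t], so [d ^- i * t = t * d ^+ i]. The two parts give the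
    even and odd exponents in the sum of [cocycle_ex]. *)
Lemma dihedral_conj (s t r : W) i : S s -> S t ->
  (((s * t) ^+ i * r * (s * t) ^- i == t) = (r == t * (s * t) ^+ (i.*2))) *
  (((s * t) ^+ i * r * (s * t) ^- i == t * s * t) =
     (r == t * (s * t) ^+ (i.*2.+1))).
Proof.
move=> Ss St; set d := s * t.
have dt : d ^- i * t = t * d ^+ i.
  elim: i => [|i IHi]; first by rewrite !expg0 invg1 mulg1 mul1g.
  rewrite [in LHS]expgS invgM -mulgA expgSr.
  have -> : d^-1 * t = t * d.
    by rewrite /d invgM !gen_inv // mulgA.
  by rewrite !mulgA IHi -!mulgA.
have E x : (d ^+ i * r * d ^- i == x) = (r == d ^- i * x * d ^+ i).
  apply/eqP/eqP => [<-|->]; first by rewrite !mulgA mulVg mul1g mulgVK.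
  by rewrite !mulgA mulgV mul1g mulgK.
split; rewrite E.
  by rewrite dt -mulgA -expgnDr addnn.
by rewrite !mulgA dt -(mulgA t) -!mulgA (mulgA s t) -/d -expgS -expgnDr addnS addnn.
Qed.

(* The reflection cocycle.  Writing [d = st], the value at [r] of its candidate on
   [d ^+ n] counts the [j < 2n] with [r = t d^j]; for [n = m s t] every such [r]
   is counted twice, so that the Coxeter relations hold. *)
Lemma cocycle_ex : exists inversion : W -> W -> bool,
  (forall x y t, inversion (x * y) t = inversion y t (+) inversion x (y * t * y^-1)) /\
  (forall s t, S s -> inversion s t = (t == s)).
Proof.
have [m [mS [relS genS univS]]] := coxS.
pose f (s : W) : wreath W := (fun t => t == s, s).
have fP s t : S s -> S t -> (f s * f t) ^+ m s t = 1.
  move=> Ss St; rewrite wreathX /= relS //; congr (_, _); apply/funext => r.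
  set d := s * t; set n := m s t.
  have -> : \big[addb/false]_(i < n)
      ((d ^+ i * r * d ^- i == t) (+) (t * (d ^+ i * r * d ^- i) * t^-1 == s)) =
      \big[addb/false]_(0 <= j < n.*2) (r == t * d ^+ j).
    rewrite -(big_mkord xpredT (fun i => (d ^+ i * r * d ^- i == t) (+)
      (t * (d ^+ i * r * d ^- i) * t^-1 == s))).
    elim: n => [|n IHn]; first by rewrite !big_geq.
    rewrite doubleS big_nat_recr //= IHn !big_nat_recr //= -addbA.
    have -> x : (t * x * t^-1 == s) = (x == t * s * t).
      rewrite gen_inv //; apply/eqP/eqP => [<-|->].
        by rewrite !mulgA gen_mulK // gen_sq // mul1g.
      by rewrite !mulgA gen_sq // mul1g gen_mulK.
    by rewrite !dihedral_conj.
  rewrite -addnn /index_iota subn0 iotaD big_cat /= add0n.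
  rewrite -{2}[n]addn0 iotaDl big_map.
  by under [X in _ (+) X]eq_bigr do rewrite expgnDr relS // mul1g; rewrite addbb.
have [phi [phiM phiS]] := univS _ f fP.
have phi1 : phi 1 = 1 by apply: (mulgI (phi 1)); rewrite -phiM !mulg1.
have phi2 w : (phi w).2 = w.
  have [e [eS <-]] := genS w; elim: e eS => [|s e IHe] eS.
    by rewrite big_nil phi1.
  rewrite big_cons phiM /= IHe => [|t te]; last by apply: eS; rewrite inE te orbT.
  by rewrite phiS //; apply: eS; rewrite inE eqxx.
exists (fun w => (phi w).1); split => [x y t|s t Ss]; last by rewrite phiS.
by rewrite phiM /= phi2.
Qed.

(* [inversion w t] means that [t] is a reflection with [len (w * t) < len w]. *)
Definition inversion : W -> W -> bool := proj1_sig (cid cocycle_ex).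

Lemma inversionM x y t : inversion (x * y) t = inversion y t (+) inversion x (y * t * y^-1).
Proof. exact: (proj2_sig (cid cocycle_ex)).1. Qed.

Lemma inversion_gen s t : S s -> inversion s t = (t == s).
Proof. exact: (proj2_sig (cid cocycle_ex)).2. Qed.

Lemma inversion1 t : inversion 1 t = false.
Proof.
have := inversionM 1 1 t; rewrite !mulg1 mul1g invg1 mulg1.
by case: (inversion 1 t).
Qed.

Lemma inversionV x t : inversion x^-1 (x * t * x^-1) = inversion x t.
Proof.
have := inversionM x^-1 x t; rewrite mulVg inversion1.
by case: inversion; case: inversion.
Qed.

Lemma inversion_mulr_gen x s : S s -> inversion (x * s) s = ~~ inversion x s.
Proof.
by move=> Ss; rewrite inversionM (inversion_gen _ Ss) eqxx gen_inv // gen_mulK.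
Qed.

Lemma expression_ex w : exists e, is_expression S e w.
Proof. by have [m [_ [_]]] := coxS. Qed.

(** Induction on the first letter [s]: by the cocycle rule either [t] is an inversion of the tail,
    or the tail conjugates [t] to [s] and [s] itself is deleted. *)
Lemma strong_exchange e w t : is_expression S e w -> inversion w t ->
  exists e', [/\ subseq e' e, size e = (size e').+1 & is_expression S e' (w * t)].
Proof.
elim: e w => [|s e IHe] w [eS <-{w}]; first by rewrite big_nil inversion1.
have Ss : S s by apply: eS; rewrite inE eqxx.
have eS' r : r \in e -> S r by move=> re; apply: eS; rewrite inE re orbT.
rewrite big_cons; set w := \prod_(r <- e) r.
rewrite inversionM (inversion_gen _ Ss); case wt : (inversion w t) => /=.
  move=> _; have [e' [se' ze' [e'S pe']]] := IHe w (conj eS' erefl) wt.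
  exists (s :: e'); split; rewrite ?eqxx //= ?ze' //.
  split; last by rewrite big_cons pe' mulgA.
  by move=> r; rewrite inE => /orP[/eqP-> //|]; exact: e'S.
move=> /eqP sE; exists e; split => //; first exact: subseq_cons.
split=> //; rewrite -/w -mulgA; have -> : w * t = s * w by rewrite -sE mulgVK.
by rewrite gen_mulVK.
Qed.

(** Such a [t] is conjugate to a letter of any expression of [w]. *)
Lemma inversion_sq w t : inversion w t -> t * t = 1.
Proof.
have [e [eS <-]] := expression_ex w; elim: e eS => [|s e IHe] eS.
  by rewrite big_nil inversion1.
rewrite big_cons inversionM; set x := \prod_(r <- e) r in IHe *.
case xt : (inversion x t) => /=.
  by move=> _; apply: IHe => // r re; apply: eS; rewrite inE re orbT.
have Ss : S s by apply: eS; rewrite inE eqxx.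
rewrite (inversion_gen _ Ss) => /eqP /(congr1 (fun y => x^-1 * (y * y) * x)).
by rewrite /= (gen_sq Ss) mulg1 mulVg !mulgA mulVg mul1g !mulgVK.
Qed.

Lemma reduced_ex w : exists e, reduced_expression S e w.
Proof.
have [e0 e0P] := expression_ex w.
have [n] := ubnP (size e0); elim: n e0 e0P => // n IHn e eP en.
have [[e' e'P e'e]|H] := pselect (exists2 e', is_expression S e' w & (size e' < size e)%N).
  by apply: (IHn e' e'P); apply: leq_trans e'e _.
by exists e; split => // e' e'P; rewrite leqNgt; apply/negP => e'e; apply: H; exists e'.
Qed.

Local Notation len := (coxeter_length S).

Lemma reduced_len e w : reduced_expression S e w -> size e = len w.
Proof.
move=> eP; rewrite /coxeter_length; case: xgetP => [_ -> [e' e'P <-]|/(_ (size e))].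
  by apply/eqP; rewrite eqn_leq eP.2 ?e'P.2 //; [exact: eP.1|exact: e'P.1].
by case; exists e.
Qed.

Lemma len_expression e w : is_expression S e w -> (len w <= size e)%N.
Proof.
by have [e' e'P] := reduced_ex w; rewrite -(reduced_len e'P); apply: e'P.2.
Qed.

Lemma inversion_len w t : inversion w t -> (len (w * t) < len w)%N.
Proof.
have [e eP] := reduced_ex w => wt.
have [e' [_ ze' e'P]] := strong_exchange eP.1 wt.
by rewrite -(reduced_len eP) ze' ltnS; exact: len_expression.
Qed.

(** If [s] is not an inversion of [w], it is one of [w * s], so [w * s] is longer. *)
Lemma descentE w s : right_descents S w s <-> S s /\ inversion w s.
Proof.
split=> -[Ss ws]; split => //; last exact: inversion_len.
apply: contraTT ws => nws; rewrite -leqNgt ltnW //.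
by rewrite -{1}(gen_mulK w Ss) inversion_len // inversion_mulr_gen.
Qed.

(* Bruhat order as generated by reflections; [bruhat_leE] identifies it with the
   subword order. *)
Definition bstep x y := exists2 t, inversion y t & x = y * t.

Inductive ble : W -> W -> Prop :=
| ble_refl x : ble x x
| ble_step x y z : bstep x y -> ble y z -> ble x z.

Lemma ble_trans x y z : ble x y -> ble y z -> ble x z.
Proof. by elim=> // {x y}x y y' xy _ IH /IH; exact: ble_step. Qed.

Lemma ble1 x y : bstep x y -> ble x y.
Proof. by move=> xy; apply: ble_step xy (ble_refl y). Qed.

Lemma ble_len x y : ble x y -> x = y \/ (len x < len y)%N.
Proof.
elim=> {x y}[|x y z [t yt ->] _]; first by left.
have lt := inversion_len yt.
by move=> [<-|yz]; right => //; apply: ltn_trans yz.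
Qed.

Lemma ble_antisym x y : ble x y -> ble y x -> x = y.
Proof.
move=> /ble_len[//|xy] /ble_len[//|yx].
by have := ltn_trans xy yx; rewrite ltnn.
Qed.

Lemma bstep_inv x y : bstep x y -> bstep x^-1 y^-1.
Proof.
move=> [t yt ->]; exists (y * t * y^-1); first by rewrite inversionV.
rewrite invgM !mulgA mulVg mul1g; congr (_ * _).
by apply: (mulgI t); rewrite mulgV (inversion_sq yt).
Qed.

Lemma ble_inv x y : ble x y -> ble x^-1 y^-1.
Proof.
by elim=> {x y}[x|x y z /bstep_inv xy _]; [exact: ble_refl|exact: ble_step].
Qed.

(** A step by [t] other than [s] becomes a step by [s * t * s], since the only inversion of [s] is
    [s]. *)
Lemma bstep_mulr x y s : S s -> bstep x y -> y = x * s \/ bstep (x * s) (y * s).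
Proof.
move=> Ss [t yt ->]; have [ts|/eqP ts] := pselect (t = s).
  by left; rewrite ts gen_mulK.
right; exists (s * t * s); last by rewrite !mulgA gen_mulK.
rewrite inversionM (inversion_gen _ Ss) (gen_inv Ss) !mulgA.
rewrite (gen_mulK _ Ss) (gen_sq Ss) mul1g yt.
rewrite addbT; apply: contra ts => /eqP sts; apply/eqP.
apply: (mulgI s); apply: (mulIg s); by rewrite sts gen_mulK.
Qed.

Lemma bstep_descent w s : S s -> inversion w s -> bstep (w * s) w.
Proof. by move=> Ss ws; exists s. Qed.

Lemma ble_mulr x y s : S s -> ble x y -> ble (x * s) (y * s) \/ ble x (y * s).
Proof.
move=> Ss; elim=> {x y}[x|x y z xy yz [IH|IH]]; first by left; exact: ble_refl.
  have [yE|xys] := bstep_mulr Ss xy; last by left; exact: ble_step xys IH.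
  by right; move: IH; rewrite yE gen_mulK.
by right; exact: ble_step xy IH.
Qed.

(** The lifting property. Along a chain of steps, multiplication by [s] keeps each step until the
    chain meets an element with inversion [s] or a step that is multiplication by [s]. *)
Lemma ble_lift x y s :
  S s -> inversion y s -> ~~ inversion x s -> ble x y -> ble (x * s) y /\ ble x (y * s).
Proof.
move=> Ss ys nxs xy.
have yss : ble (y * s) y by exact/ble1/bstep_descent.
have xxs : ble x (x * s).
  by apply/ble1; rewrite -{1}(gen_mulK x Ss); apply: bstep_descent;
     rewrite ?inversion_mulr_gen.
suff xsy : ble (x * s) y.
  by split=> //; have [/(ble_trans xxs)|] := ble_mulr Ss xy.
elim: xy nxs {xxs} ys yss => {x y}[x /negP//|x y z xy yz IH] nxs zs zss.
have [yE|xys] := bstep_mulr Ss xy; first by rewrite -yE.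
have [ys|nys] := boolP (inversion y s); last by apply: ble_step xys (IH _ _ _).
apply: ble_step xys (ble_trans _ yz); exact/ble1/bstep_descent.
Qed.

Lemma ble_descents x y s :
  S s -> inversion x s -> inversion y s -> ble x y -> ble (x * s) (y * s).
Proof.
move=> Ss xs ys xy; have [//|] := ble_mulr Ss xy.
by apply: ble_trans; apply/ble1/bstep_descent.
Qed.

Lemma ble_bruhat x y : ble x y -> bruhat_le S x y.
Proof.
move=> xy e [eP _].
have [e' [se' [_ e'P]]] : exists e', subseq e' e /\ is_expression S e' x.
  elim: xy eP => {x y}[x eP|x y z [t yt ->] _ IH /IH[e' [se' e'P]]].
    by exists e.
  have [e'' [se'' _ e''P]] := strong_exchange e'P yt.
  by exists e''; split => //; apply: subseq_trans se'.
by exists e'.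
Qed.

(** Were [s] not an inversion of [w], strong exchange for [w * s] would give an expression of [w]
    two letters shorter. *)
Lemma reduced_rcons e s w : reduced_expression S (rcons e s) w ->
  [/\ S s, inversion w s & reduced_expression S e (w * s)].
Proof.
move=> [[eS eP] er]; have Ss : S s by apply: eS; rewrite mem_rcons inE eqxx.
have wsE : is_expression S e (w * s).
  split; first by move=> r re; apply: eS; rewrite mem_rcons inE re orbT.
  by rewrite -eP big_rcons gen_mulK.
have er' e' : is_expression S e' (w * s) -> (size e <= size e')%N.
  move=> [e'S e'P]; rewrite -ltnS -(size_rcons e s) -(size_rcons e' s).
  apply: er; split; last by rewrite big_rcons /= e'P gen_mulK.
  by move=> r; rewrite mem_rcons inE => /orP[/eqP->//|]; exact: e'S.
split=> //; apply/negP => /negP nws.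
have : inversion (w * s) s by rewrite inversion_mulr_gen.
move=> /(strong_exchange wsE)[e' [_ ze' [e'S]]]; rewrite gen_mulK // => e'P.
have := er e' (conj e'S e'P); rewrite size_rcons ze'.
by rewrite ltnNge => /negP; apply; rewrite leqW.
Qed.

(** Induction on the last letter [s] of a reduced expression of [y]: a subword not using it lies
    below [y * s], and one ending in it is handled by lifting. *)
Lemma bruhat_ble x y : bruhat_le S x y -> ble x y.
Proof.
have [e eP] := reduced_ex y => /(_ e eP)[e' se' <-{x}].
elim/last_ind: e e' y eP se' => [|e s IHe] e' y eP.
  by rewrite subseq0 => /eqP->; case: eP => -[_ <-] _; exact: ble_refl.
have [Ss ys eP'] := reduced_rcons eP.
have yss : ble (y * s) y by exact/ble1/bstep_descent.
elim/last_ind: e' => [|e' t _] se'.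
  rewrite big_nil; apply: ble_trans yss.
  by have := IHe [::] _ eP' (sub0seq _); rewrite big_nil.
rewrite big_rcons; have [tsE|ts] := eqVneq t s.
  have /(IHe _ _ eP') : subseq e' e.
    by move: se'; rewrite tsE -!cats1 subseq_cat2r.
  set x := \prod_(r <- e') r => xys.
  rewrite tsE; have [xs|nxs] := boolP (inversion x s).
    by apply: ble_trans (ble_trans xys yss); apply/ble1/bstep_descent.
  exact: (ble_lift Ss ys nxs (ble_trans xys yss)).1.
rewrite -big_rcons; apply: ble_trans (IHe _ _ eP' _) yss.
(* As [subseq] compares heads, both words are reversed to discard the unmatched last letter [s]. *)
move: se'; rewrite -[subseq _ (rcons _ _)]subseq_rev -[subseq (rcons _ _) e]subseq_rev.
rewrite !rev_rcons.
by rewrite /= (negPf ts).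
Qed.

Lemma bruhat_leE : bruhat_le S = ble.
Proof.
apply/funext => x; apply/funext => y; apply/propext.
by split; [exact: bruhat_ble|exact: ble_bruhat].
Qed.

(** * Twisted identities and the lowering map *)

Section Twisted.
Variable theta : W -> W.
Hypothesis thetaP : coxeter_automorphism S theta.
Hypothesis thetaK : involutive theta.

Local Notation iota := (twisted_identities theta).

Lemma thetaM x y : theta (x * y) = theta x * theta y.
Proof. by have [] := thetaP. Qed.

Lemma theta1 : theta 1 = 1.
Proof. by apply: (mulgI (theta 1)); rewrite -thetaM !mulg1. Qed.

Lemma thetaV x : theta x^-1 = (theta x)^-1.
Proof. by apply: (mulgI (theta x)); rewrite -thetaM !mulgV; exact: theta1. Qed.

Lemma thetaS s : S s -> S (theta s).
Proof. by have [_ _ SE] := thetaP => Ss; rewrite -SE; exists s. Qed.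

Lemma theta_eq x y : (theta x == theta y) = (x == y).
Proof. by rewrite (inj_eq (inv_inj thetaK)). Qed.

Lemma inversion_theta w t : inversion (theta w) (theta t) = inversion w t.
Proof.
have [e [eS <-]] := expression_ex w; elim: e eS => [|s e IHe] eS.
  by rewrite big_nil theta1 !inversion1.
have Ss : S s by apply: eS; rewrite inE eqxx.
rewrite big_cons; move: (\prod_(r <- e) r) IHe => x IHe.
rewrite thetaM !inversionM (inversion_gen _ Ss) (inversion_gen _ (thetaS Ss)) IHe.
  by rewrite -thetaV -!thetaM theta_eq.
by move=> r re; apply: eS; rewrite inE re orbT.
Qed.

Lemma bstep_theta x y : bstep x y -> bstep (theta x) (theta y).
Proof.
by move=> [t yt ->]; exists (theta t); rewrite ?inversion_theta ?thetaM.
Qed.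

Lemma ble_theta x y : ble x y -> ble (theta x) (theta y).
Proof.
by elim=> {x y}[x|x y z /bstep_theta xy _]; [exact: ble_refl|exact: ble_step].
Qed.

Lemma iota_theta x : iota x -> theta x = x^-1.
Proof. by move=> [w _ <-]; rewrite thetaM thetaK invgM -thetaV invgK. Qed.

Lemma iota_twist x s : S s -> iota x -> iota (theta s * x * s).
Proof.
move=> Ss [w _ <-]; exists (w * s) => //.
by rewrite /= invgM thetaM (gen_inv Ss) !mulgA.
Qed.

(* An automorphism of the Bruhat order fixing the twisted identities; it
   exchanges right multiplication by [s] with left multiplication by [theta s]. *)
Definition dagger x := (theta x)^-1.

Lemma ble_dagger x y : ble x y -> ble (dagger x) (dagger y).
Proof. by move=> /ble_theta /ble_inv. Qed.

Lemma dagger_iota x : iota x -> dagger x = x.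
Proof. by move=> /iota_theta; rewrite /dagger => ->; rewrite invgK. Qed.

Lemma dagger_mulr x s : S s -> iota x -> dagger (x * s) = theta s * x.
Proof.
move=> Ss /iota_theta xE.
by rewrite /dagger thetaM xE invgM invgK (gen_inv (thetaS Ss)).
Qed.

(* If [x = theta w^-1 * w] is fixed by [s], then the reflection
   [w s w^-1] is fixed by [theta], and the two contributions to [inversion x s]
   cancel. *)
Lemma iota_descent x s :
  S s -> iota x -> inversion x s -> theta s * x * s <> x.
Proof.
move=> Ss [w _ <-] xs xE; move: xs.
have tE : theta (w * s * w^-1) = w * s * w^-1.
  apply: (mulIg (w * s)); move/(congr1 (fun y => theta w * y)): xE.
  by rewrite !thetaM thetaV !mulgA mulgV mul1g mulgVK gen_mulK.
by rewrite inversionM -tE inversion_theta inversionV addbb.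
Qed.

(** By the cocycle rule the two sides differ only if [x * s * x^-1 = theta s], that is, if [x] is
    fixed. *)
Lemma inversion_twist x s :
  S s -> theta s * x * s <> x -> inversion (theta s * x) s = inversion x s.
Proof.
move=> Ss xE; rewrite inversionM (inversion_gen _ (thetaS Ss)).
have [E|] := eqVneq (x * s * x^-1); last by rewrite addbF.
by case: xE; rewrite -E mulgVK gen_mulK.
Qed.

(** This is the map [f] in the idea of the proof. *)
Definition lower s x := if inversion x s then theta s * x * s else x.

Lemma iota_lower s x : S s -> iota x -> iota (lower s x).
Proof. by move=> Ss ix; rewrite /lower; case: ifP => // _; apply: iota_twist. Qed.

Lemma inversion_lower s x : S s -> iota x -> ~~ inversion (lower s x) s.
Proof.
move=> Ss ix; rewrite /lower; case: ifPn => // xs.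
by rewrite inversion_mulr_gen // inversion_twist ?xs //; apply: iota_descent.
Qed.

(** Two descents: [theta s * x] is below [x] by [dagger], and still has the descent [s]. *)
Lemma lower_le s x : S s -> iota x -> ble (lower s x) x.
Proof.
move=> Ss ix; rewrite /lower; case: ifP => xs; last exact: ble_refl.
have xss : ble (x * s) x by exact/ble1/bstep_descent.
have := ble_dagger xss; rewrite dagger_mulr // dagger_iota //.
apply: ble_trans; apply/ble1/bstep_descent => //.
by rewrite inversion_twist //; apply: iota_descent.
Qed.

(** When [s] is a descent of [y], the comparison is made for right multiplication, carried by
    [dagger] to [theta s * y], and made there once more. *)
Lemma lower_mono s x y :
  S s -> iota x -> iota y -> ble x y -> ble (lower s x) (lower s y).
Proof.
move=> Ss ix iy xy; rewrite {2}/lower; case: ifP => ys; last first.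
  exact: ble_trans (lower_le Ss ix) xy.
have nys : inversion (theta s * y) s by rewrite inversion_twist //; apply: iota_descent.
rewrite /lower; case: ifPn => xs.
  have := ble_dagger (ble_descents Ss xs ys xy); rewrite !dagger_mulr //.
  apply: ble_descents => //.
  by rewrite inversion_twist //; apply: iota_descent.
have := ble_dagger (ble_lift Ss ys xs xy).2.
rewrite dagger_mulr // dagger_iota // => xy'.
exact: (ble_lift Ss nys xs xy').2.
Qed.

(** Lifting gives [u * s] below [v], [dagger] turns this into [theta s * u] below [v], and lifting
    applies again. *)
Lemma twist_lift u v s : S s -> iota u -> iota v -> inversion v s -> ~~ inversion u s ->
  theta s * u * s <> u -> ble u v ->
  [/\ inversion (theta s * u * s) s, lower s (theta s * u * s) = u,
      ble u (theta s * u * s) & ble (theta s * u * s) v].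
Proof.
move=> Ss iu iv vs us uE uv.
have nus : ~~ inversion (theta s * u) s by rewrite inversion_twist.
have pE : inversion (theta s * u * s) s by rewrite inversion_mulr_gen.
have lE : lower s (theta s * u * s) = u.
  by rewrite /lower pE !mulgA gen_mulK // (gen_sq (thetaS Ss)) mul1g.
split=> //; first by rewrite -{1}lE; apply: lower_le => //; apply: iota_twist.
have := ble_dagger (ble_lift Ss vs us uv).1.
rewrite dagger_mulr // dagger_iota // => uv'.
exact: (ble_lift Ss vs nus uv').1.
Qed.

(** All elements below [v] are subwords of one reduced expression; this makes the complexes
    finite. *)
Lemma ble_finite v : finite_set [set x | ble x v].
Proof.
have [e eP] := reduced_ex v.
apply: (@sub_finite_set _ _ [set` [seq \prod_(s <- mask m e) s | m : (size e).-tuple bool]]).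
  move=> x /ble_bruhat /(_ e eP)[e' /subseqP[m sm ->] <-] /=.
  have mP : size m == size e by apply/eqP.
  by apply/mapP; exists (Tuple mP); rewrite ?mem_enum.
exact: finite_seq.
Qed.

(** * The interval from [u] to [v] *)

Section TwistedInterval.
Variables (u v s : W).
Hypothesis Ss : S s.
Hypothesis iu : iota u.
Hypothesis iv : iota v.
Hypothesis uv : ble u v.
Hypothesis vs : inversion v s.
Hypothesis us : ~~ inversion u s.
Hypothesis twist_u : theta s * u * s <> u.

Local Notation low := (lower s).
Let p := theta s * u * s.

Let ip : iota p. Proof. exact: iota_twist. Qed.
Let pP : [/\ inversion p s, low p = u, ble u p & ble p v].
Proof. exact: (twist_lift Ss iu iv vs us twist_u uv). Qed.

Lemma lower_source : low u = u. Proof. by rewrite /lower (negPf us). Qed.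

Lemma lower_eq_source x : low x = u -> x = u \/ x = p.
Proof.
rewrite /lower; case: ifP => _; last by left.
by move=> xu; right; rewrite /p -xu !mulgA gen_mulK // (gen_sq (thetaS Ss)) mul1g.
Qed.

(** Lowering squeezes [low x] between [low u = u] and [low p = u]. This makes [p] minimal in the
    interval. *)
Lemma no_between x : iota x -> ble u x -> ble x p -> x = u \/ x = p.
Proof.
move=> ix ux xp; apply: lower_eq_source; have [_ lp _ _] := pP.
apply: (@ble_antisym).
  by rewrite -[X in ble _ X]lp; apply: lower_mono.
by rewrite -[X in ble X _]lower_source; apply: lower_mono.
Qed.

Lemma interval_suspension (R : realType) : p <> v ->
  homotopy_equivalent R
    (realization R (order_complex ble (open_interval ble iota u v)))
    (realization R (suspension (order_complex ble (open_interval ble iota p v)))).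
Proof.
move=> pv; have [ps lp up pv'] := pP.
have pu : p <> u by move=> pu; move: us; rewrite -pu ps.
set A := open_interval ble iota u v.
have -> : open_interval ble iota p v = [set x | [/\ A x, ble p x & x <> p]].
  apply/seteqP; split => x /=.
    move=> [ix [px npx] [xv nxv]]; split=> //; last by move=> xp; apply: npx.
    split=> //; split; first exact: ble_trans px.
    by move=> ux; apply: pu; apply: (@ble_antisym) => //; rewrite ux.
  by move=> [[ix [ux nux] [xv nxv]] px nxp]; split=> //; split=> // /esym.
have [r0 r0A] : exists r : seq W, [set x | ble x v] = [set` r].
  by apply/finite_seqP; exact: ble_finite.
have lowP x : A x -> x <> p -> [/\ A (low x), low x <> p, ble (low x) x & ble (low x) (low v)].
  move=> [ix [ux nux] [xv nxv]] nxp.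
  have nlp : ~~ inversion (low x) s by apply: inversion_lower.
  have lx : ble (low x) x by exact: lower_le.
  split=> //; last exact: lower_mono.
    split; first exact: iota_lower.
      split; first by rewrite -lower_source; apply: lower_mono.
      by move=> /esym /lower_eq_source[xu|//]; apply: nux.
    split; first exact: ble_trans xv.
    by move=> lv; move: nlp; rewrite lv vs.
  by move=> lxp; move: nlp; rewrite lxp ps.
have nlv : ~~ inversion (low v) s by apply: inversion_lower.
(* The point [c] is [low v]: it differs from [v] and [p] because it lacks the descent [s], and from
   [u] because [v] is neither [u] nor [p]. *)
apply: (@poset_suspension R W ble _ _ _ A p (low v) low (undup r0)).
- exact: ble_refl.
- exact: ble_trans.
- exact: ble_antisym.
- exact: undup_uniq.
- move=> x [_ _ [xv _]]; rewrite mem_undup.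
  by have : [set x | ble x v] x by []; rewrite r0A.
- by split=> //; split=> // /esym.
- move=> x [ix [ux nux] _] xp.
  by have [xu|//] := no_between ix ux xp; case: nux.
- split; first exact: iota_lower.
    split; first by rewrite -lower_source; apply: lower_mono.
    by move=> /esym /lower_eq_source[vu|/esym//]; move: us; rewrite -vu vs.
  split; first exact: lower_le.
  by move=> lv; move: nlv; rewrite lv vs.
- by move=> lvp; move: nlv; rewrite lvp ps.
- exact: lowP.
- by move=> x y [ix _ _] _ [iy _ _] _; apply: lower_mono.
Qed.

End TwistedInterval.

End Twisted.
End CoxeterGroup.

(** * The degenerate case and the conclusion *)

Lemma empty_homotopy_equivalent (R : realType) (X Y : topologicalType) :
  (X -> False) -> (Y -> False) -> homotopy_equivalent R X Y.
Proof.
move=> X0 Y0; exists (fun x => False_rect Y (X0 x)), (fun y => False_rect X (Y0 y)).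
split; [by move=> x; case: (X0 x)|by move=> y; case: (Y0 y)|..].
  exists fst; split=> [[x t]|x|x]; by case: (X0 x).
exists fst; split=> [[x t]|x|x]; by case: (Y0 x).
Qed.

Theorem theorem4p9 (R : realType) (W : groupType) (S : set W)
    (theta : W -> W) (u v s : W) :
  coxeter_system S ->
  finite_set S ->
  coxeter_automorphism S theta ->
  involutive theta ->
  twisted_identities theta u ->
  twisted_identities theta v ->
  bruhat_le S u v ->
  right_descents S v s ->
  ~ right_descents S u s ->
  twisted_star theta u s = (theta s * u * s)%g ->
  homotopy_equivalent R
    (realization R
       (interval_complex (bruhat_le S) (twisted_identities theta) u v))
    (realization R
       (suspension
          (interval_complex (bruhat_le S) (twisted_identities theta)
             (twisted_star theta u s) v))).
Proof.
move=> coxS _ thetaP thetaK iu iv; rewrite (bruhat_leE coxS) => uv.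
move=> /(descentE coxS)[Ss vs] nus starE; rewrite starE.
have us : ~~ inversion coxS u s by apply/negP => us; apply: nus; apply/(descentE coxS).
(* If [u] were fixed, [twisted_star] would give [u * s = u], against the change of inversion at
   [s]. *)
have pu : (theta s * u * s)%g <> u.
  move=> pu; move: starE; rewrite /twisted_star pu eqxx => usu.
  by have := inversion_mulr_gen coxS u Ss; rewrite usu; case: (inversion coxS u s).
have nuv : u <> v by move=> uv'; move: us; rewrite uv' vs.
have [_ _ _ pv] := twist_lift thetaP thetaK Ss iu iv vs us pu uv.
rewrite /interval_complex asboolT //.
(* If [u] is covered by [v = theta s * u * s], both realizations are empty: the open interval has no
   vertex to carry weight, and the suspension of the void complex has no face. *)
have [pE|npv] := pselect ((theta s * u * s)%g = v); last first.
  rewrite asboolT //; exact: interval_suspension.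
rewrite asboolF => [|[_ //]]; apply: empty_homotopy_equivalent => x; last first.
  by have [] := vsupp_face x.
have [_ [_ sA _] x1] := proj2_sig x.
have x0 w : sval x w = 0%R.
  apply/eqP/negP => /negP /sA[iw [uw nuw] [wv nwv]]; rewrite -pE in wv nwv.
  by have [/esym|] := no_between thetaP thetaK Ss iu iv uv vs us pu iw uw wv.
move: x1; rewrite fsbig1 => [/esym/eqP|w _]; last exact: x0.
by rewrite oner_eq0.
Qed.
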